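(* For $0<d_m\le\frac1{SA}$, let $\mathcal M_{d_m}:=\{(\mu,M):\min_{t,s_t,a_t}d^\mu_t(s_t,a_t)\ge d_m\}$, where $M$ ranges over finite-horizon tabular MDPs with stationary transitions, $S$ states, $A$ actions and horizon $H$, and $\mu$ over behavior policies. There exist universal constants $c_1,c_2,c,p>0$ such that, whenever $H,S,A\ge c_1$ and $0<\epsilon<c_2$, if $n\le cH^2/(d_m\epsilon^2)$ then \[ \inf_{\mathrm{alg}}\ \sup_{(\mu,M)\in\mathcal M_{d_m}}\mathbb P_{\mu,M}\big(v^\star-v^{\pi_{\mathrm{alg}}}\ge\epsilon\big)\ge p, \] where the infimum is over all algorithms that output a policy $\pi_{\mathrm{alg}}$ from $n$ episodes of offline data generated by $\mu$ on $M$.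
   Context: A finite-horizon MDP has finite state/action sets, horizon $H$, rewards in $[0,1]$, a transition kernel $P$ identical at all steps (stationary), and initial distribution $d_1$. Offline data: $n$ i.i.d. episodes obtained by running the behavior policy $\mu$ in $M$. $d^\mu_t(s,a)=\mathbb P^\mu(s_t=s,a_t=a)$. For a policy $\pi$, $v^\pi=\mathbb E^\pi[\sum_{t=1}^Hr_t]$ (with $s_1\sim d_1$) and $v^\star=\sup_\pi v^\pi$. $\mathbb P_{\mu,M}$ denotes probability over the data and the algorithm. *)

(* Defs.v *)
From HB Require Import structures.
From mathcomp Require Import all_boot all_order all_algebra.
From mathcomp Require Import all_classical all_reals all_analysis.
Set Implicit Arguments. Unset Strict Implicit. Unset Printing Implicit Defensive.
Import Order.TTheory GRing.Theory Num.Theory.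
Local Open Scope ring_scope.

(* Finite-horizon tabular MDPs with S states ('I_S), A actions ('I_A) and
   horizon H; step t : 'I_H stands for step t+1 of the paper. *)
Section MDP.
Variables (R : realType) (S A H : nat).

Record mdp := MDP {
  init : 'I_S -> R;
  trans : 'I_S -> 'I_A -> 'I_S -> R;
  rew : 'I_H -> 'I_S -> 'I_A -> R }.

Definition prob_vec (m : nat) (p : 'I_m -> R) :=
  (forall i, 0 <= p i) /\ \sum_(i < m) p i = 1.

Definition valid_mdp (M : mdp) :=
  prob_vec (init M) /\ (forall s a, prob_vec (trans M s a)) /\
  (forall t s a, 0 <= rew M t s a <= 1).

Definition policy := 'I_H -> 'I_S -> 'I_A -> R.
Definition valid_policy (pi : policy) := forall t s, prob_vec (pi t s).

Definition traj := {ffun 'I_H -> 'I_S * 'I_A}.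

Definition prev (t : 'I_H) : option 'I_H :=
  if (t : nat) is k.+1 then insub k else None.

Definition state_factor (M : mdp) (tau : traj) (t : 'I_H) : R :=
  match prev t with
  | None => init M (tau t).1
  | Some u => trans M (tau u).1 (tau u).2 (tau t).1
  end.

Definition traj_prob (M : mdp) (pi : policy) (tau : traj) : R :=
  \prod_(t < H) (state_factor M tau t * pi t (tau t).1 (tau t).2).

Definition value (M : mdp) (pi : policy) : R :=
  \sum_(tau : traj) traj_prob M pi tau * \sum_(t < H) rew M t (tau t).1 (tau t).2.

Definition occupancy (M : mdp) (pi : policy) (t : 'I_H) (s : 'I_S) (a : 'I_A) : R :=
  \sum_(tau : traj | tau t == (s, a)) traj_prob M pi tau.

Definition opt_value (M : mdp) : R :=
  sup [set v | exists pi, valid_policy pi /\ v = value M pi]%classic.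

Definition dataset (n : nat) := 'I_n -> 'I_H -> 'I_S * 'I_A * R.

Definition observe (n : nat) (M : mdp) (D : {ffun 'I_n -> traj}) : dataset n :=
  fun i t => ((D i t).1, (D i t).2, rew M t (D i t).1 (D i t).2).

Definition data_prob (n : nat) (M : mdp) (mu : policy) (D : {ffun 'I_n -> traj}) : R :=
  \prod_(i < n) traj_prob M mu (D i).

(* P_{mu,M}( v^* - v^{pi_alg} >= eps ) for a randomized algorithm whose
   internal randomness is w ~ Pr. *)
Definition fail_prob (d : measure_display) (Om : measurableType d)
  (Pr : probability Om R) (n : nat) (alg : Om -> dataset n -> policy)
  (M : mdp) (mu : policy) (eps : R) : \bar R :=
  (\sum_(D : {ffun 'I_n -> traj})
     (data_prob M mu D)%:E *
     Pr [set w | (eps <= opt_value M - value M (alg w (observe M D)))%R]%classic)%E.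

End MDP.

(* Main.v *)
Require Import Defs.
From HB Require Import structures.
From mathcomp Require Import all_boot all_order all_algebra.
From mathcomp Require Import all_classical all_reals all_analysis.
From mathcomp Require Import measurable_realfun.
From mathcomp Require Import ring lra zify.
Set Implicit Arguments. Unset Strict Implicit. Unset Printing Implicit Defensive.
Import Order.TTheory GRing.Theory Num.Theory.
Local Open Scope ring_scope.

(* Assouad's method, with perturbations that the behavior policy averages out.
   The states are split into pairs (low, high); only high states are rewarded,
   and each step swaps the two states of a pair with probability 1/(4H).  In a
   low state s a hidden bit decides which of the actions 0 and 1 multiplies the
   swap probability by 1 + delta, the other one multiplying it by 1 - delta.
   The behavior policy gives both actions the same mass q = S d_m, so its state
   marginals are uniform for every choice of the bits and all occupancies are
   at least q / S = d_m, even in the extreme case d_m = 1/(SA).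

   Choosing the wrong action during the first half of the episode costs about
   delta/H probability of being in the high state during the whole second half,
   so the regret is of order delta H, chosen proportional to eps, times the
   fraction of mismatches.
   Flipping one bit changes the law of an episode by a chi^2-divergence of at
   most 32 delta^2 q / S, hence n episodes with n d_m delta^2 <= 1/64 do not
   determine the bit, and under uniform random bits every algorithm mismatches
   half of the time, up to a constant.  As the mismatch part of the regret is
   bounded by a multiple of its average, it exceeds eps with constant
   probability for some choice of the bits. *)

(** * Path sums and state marginals *)

Section PathSums.
Variables (R : realType) (S A : nat) (x0 : 'I_S * 'I_A).
(* [P] is not assumed stochastic: [sum_path_last] is also applied to the
   unnormalised kernel [tilted_mdp]. *)
Variables (nu : 'I_S -> R) (P : 'I_S -> 'I_A -> 'I_S -> R).
Variable pi : nat -> 'I_S -> 'I_A -> R.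

(** Trajectories become functions on [nat], so that horizons can grow or shrink without casts
    between ordinals; [x0] fills the positions beyond the horizon. *)
Definition pad h (tau : traj S A h) (k : nat) : 'I_S * 'I_A :=
  if insub k is Some i then tau i else x0.

Definition upd (f : nat -> 'I_S * 'I_A) h y k := if k == h then y else f k.

Definition entry (f : nat -> 'I_S * 'I_A) (t : nat) : R :=
  if t is k.+1 then P (f k).1 (f k).2 (f t).1 else nu (f 0%N).1.

Definition path_weight h (f : nat -> 'I_S * 'I_A) : R :=
  \prod_(t < h) (entry f t * pi t (f t).1 (f t).2).

Fixpoint law (t : nat) (s : 'I_S) : R :=
  if t is k.+1 then \sum_s' law k s' * \sum_a pi k s' a * P s' a s else nu s.

Lemma pad_ord h (tau : traj S A h) (i : 'I_h) : pad tau i = tau i.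
Proof. by rewrite /pad valK. Qed.

(** A trajectory of length h+1 is a trajectory of length h together with its last state-action
    pair. *)
Lemma sum_traj_recr h (G : (nat -> 'I_S * 'I_A) -> R) :
  \sum_(tau : traj S A h.+1) G (pad tau) =
  \sum_(tau : traj S A h) \sum_y G (upd (pad tau) h y).
Proof.
rewrite pair_big /=.
pose ext (p : traj S A h * ('I_S * 'I_A)) : traj S A h.+1 :=
  [ffun i : 'I_h.+1 => upd (pad p.1) h p.2 i].
rewrite (reindex ext) /=; last first.
  exists (fun tau : traj S A h.+1 =>
    ([ffun i : 'I_h => tau (widen_ord (leqnSn h) i)], tau ord_max)) => [[tau y] _|tau _].
    rewrite /ext; congr pair; last by rewrite ffunE /upd eqxx.
    by apply/ffunP=> i; rewrite !ffunE /upd /= ltn_eqF ?ltn_ord// pad_ord.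
  apply/ffunP=> i; rewrite ffunE /upd /=; case: eqP => [ih|/eqP ih].
    by congr (tau _); apply/val_inj.
  have lti : (i < h)%N by rewrite ltn_neqAle ih -ltnS ltn_ord.
  by rewrite -[nat_of_ord i]/(nat_of_ord (Ordinal lti)) pad_ord ffunE; congr (tau _); apply/val_inj.
apply: eq_bigr => -[tau y] _ /=; congr G; apply/funext => k.
rewrite {1}/pad; case: insubP => [i _ <-|]; first by rewrite ffunE.
rewrite -leqNgt => hk; rewrite /upd gtn_eqF// /pad insubN// -leqNgt; exact: ltnW.
Qed.

Lemma path_weight_upd h f y :
  path_weight h.+1 (upd f h y) =
  path_weight h f * (entry (upd f h y) h * pi h y.1 y.2).
Proof.
rewrite /path_weight big_ord_recr /=; congr (_ * _); last by rewrite /upd eqxx.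
apply: eq_bigr => i _.
have ui k : (k < h)%N -> upd f h y k = f k by move=> kh; rewrite /upd ltn_eqF.
rewrite ui ?ltn_ord//; congr (_ * _).
case: i => -[|k] kh /=; first by rewrite ui.
by rewrite !ui//; exact: ltnW.
Qed.

(** Induction on the horizon: the last step is absorbed into the test function [F'] of the step
    before. Nothing is summed out after the observed time, hence no normalisation is required. *)
Lemma sum_path_last h (F : 'I_S * 'I_A -> R) :
  \sum_(tau : traj S A h.+1) path_weight h.+1 (pad tau) * F (pad tau h) =
  \sum_s \sum_a law h s * pi h s a * F (s, a).
Proof.
elim: h F => [|h IH] F.
  rewrite (sum_traj_recr _ (fun f => path_weight 1 f * F (f 0%N))).
  under eq_bigr do under eq_bigr do
    rewrite path_weight_upd /path_weight big_ord0 /entry /upd eqxx mul1r.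
  rewrite sumr_const cardT -cardE card_ffun card_ord expn0 mulr1n.
  by rewrite pair_big /=; apply: eq_bigr => -[s a].
rewrite (sum_traj_recr _ (fun f => path_weight h.+2 f * F (f h.+1))).
pose F' x := \sum_y P x.1 x.2 y.1 * pi h.+1 y.1 y.2 * F y.
transitivity (\sum_(tau : traj S A h.+1) path_weight h.+1 (pad tau) * F' (pad tau h)).
  apply: eq_bigr => tau _; rewrite big_distrr; apply: eq_bigr => y _.
  by rewrite path_weight_upd /= /upd eqxx ltn_eqF// !mulrA.
rewrite IH [RHS]pair_big /=.
rewrite [RHS](eq_bigr (fun y => \sum_s' \sum_a law h s' * pi h s' a *
    (P s' a y.1 * pi h.+1 y.1 y.2 * F y))) /=; last first.
  move=> [s a] _ /=; rewrite !big_distrl; apply: eq_bigr => s' _ /=.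
  by rewrite big_distrr !big_distrl /=; apply: eq_bigr => b _; rewrite !mulrA.
rewrite [RHS]exchange_big; apply: eq_bigr => s _ /=.
rewrite [RHS]exchange_big; apply: eq_bigr => a _ /=.
by rewrite /F' big_distrr.
Qed.

(** The steps after t sum to one, one at a time from the end, until t is the last step. *)
Lemma sum_path_at h t (F : 'I_S * 'I_A -> R) :
  (forall s a, \sum_s' P s a s' = 1) -> (forall k s, (k <= h)%N -> \sum_a pi k s a = 1) ->
  (t <= h)%N ->
  \sum_(tau : traj S A h.+1) path_weight h.+1 (pad tau) * F (pad tau t) =
  \sum_s \sum_a law t s * pi t s a * F (s, a).
Proof.
move=> P1 pi1; elim: h pi1 => [|h IH] pi1.
  by rewrite leqn0 => /eqP ->; exact: sum_path_last.
rewrite leq_eqVlt => /predU1P[->|th]; first exact: sum_path_last.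
rewrite -IH //; last by move=> k s kh; apply: pi1; exact: leqW.
rewrite (sum_traj_recr _ (fun f => path_weight h.+2 f * F (f t))).
apply: eq_bigr => tau _.
rewrite [LHS](eq_bigr (fun y => path_weight h.+1 (pad tau) * F (pad tau t) *
    (P (pad tau h).1 (pad tau h).2 y.1 * pi h.+1 y.1 y.2))); last first.
  by move=> y _; rewrite path_weight_upd /= /upd eqxx ltn_eqF// ltn_eqF// mulrAC.
rewrite -big_distrr /=.
rewrite -(pair_big xpredT xpredT (fun s a => P (pad tau h).1 (pad tau h).2 s * pi h.+1 s a)) /=.
by under eq_bigr do rewrite -big_distrr /= pi1// mulr1; rewrite P1 mulr1.
Qed.

End PathSums.

Section Occupancies.
Variables (R : realType) (S A H : nat).
Implicit Types (M : mdp R S A H) (pi : policy R S A H).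

Definition extend_policy pi (k : nat) : 'I_S -> 'I_A -> R :=
  if insub k is Some t then pi t else fun _ _ => 0.

Definition state_law M pi : nat -> 'I_S -> R :=
  law (init M) (trans M) (extend_policy pi).

Lemma extend_policy_ord pi (t : 'I_H) : extend_policy pi t = pi t.
Proof. by rewrite /extend_policy valK. Qed.

Lemma traj_probE x0 M pi (tau : traj S A H) :
  traj_prob M pi tau =
  path_weight (init M) (trans M) (extend_policy pi) H (pad x0 tau).
Proof.
apply: eq_bigr => t _; rewrite extend_policy_ord pad_ord; congr (_ * _).
rewrite /state_factor /Defs.prev /entry; case: t => -[|k] kH /=.
  by rewrite -(pad_ord x0 tau (Ordinal kH)).
rewrite (insubT (fun k => k < H)%N (ltnW kH)) /=.
by rewrite -[tau _](pad_ord x0) -[tau (Ordinal kH)](pad_ord x0).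
Qed.

Lemma state_law0 M pi s : state_law M pi 0 s = init M s.
Proof. by []. Qed.

Lemma state_lawS M pi (t : 'I_H) s :
  state_law M pi t.+1 s =
  \sum_s' state_law M pi t s' * \sum_a pi t s' a * trans M s' a s.
Proof. by rewrite /state_law /= extend_policy_ord. Qed.

End Occupancies.

Section Marginals.
Variables (R : realType) (S A : nat).

Lemma sum_traj_prob_at H (x0 : 'I_S * 'I_A) (M : mdp R S A H)
    (pi : policy R S A H) (t : 'I_H) (F : 'I_S * 'I_A -> R) :
  (forall s a, \sum_s' trans M s a s' = 1) -> (forall t s, \sum_a pi t s a = 1) ->
  \sum_(tau : traj S A H) traj_prob M pi tau * F (tau t) =
  \sum_s \sum_a state_law M pi t s * pi t s a * F (s, a).
Proof.
case: H M pi t => [|h] M pi t P1 pi1; first by case: t.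
under eq_bigr do rewrite (traj_probE x0) -(pad_ord x0).
rewrite sum_path_at//; last 2 first.
- by move=> k s kh; rewrite -[k]/(val (Ordinal (kh : (k < h.+1)%N))) extend_policy_ord.
- by rewrite -ltnS.
by rewrite extend_policy_ord.
Qed.

(** Only the policy is normalised here: for the tilted kernel the right-hand side is a mass that
    differs from 1 in general. *)
Lemma sum_traj_prob H (x0 : 'I_S * 'I_A) (M : mdp R S A H) (pi : policy R S A H) : (0 < H)%N ->
  (forall t s, \sum_a pi t s a = 1) ->
  \sum_(tau : traj S A H) traj_prob M pi tau = \sum_s state_law M pi H.-1 s.
Proof.
case: H M pi => [//|h] M pi _ pi1.
under eq_bigr do rewrite (traj_probE x0) -[path_weight _ _ _ _ _]mulr1.
rewrite (sum_path_last _ _ _ _ _ (fun=> 1)); apply: eq_bigr => s _ /=.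
under eq_bigr do rewrite mulr1.
by rewrite -big_distrr /= -[h in extend_policy _ h]/(val (@ord_max h)) extend_policy_ord pi1 mulr1.
Qed.

Lemma occupancyE H (M : mdp R S A H) (pi : policy R S A H) t s a :
  (forall s a, \sum_s' trans M s a s' = 1) -> (forall t s, \sum_a pi t s a = 1) ->
  occupancy M pi t s a = state_law M pi t s * pi t s a.
Proof.
move=> P1 pi1; rewrite /occupancy big_mkcond /=.
rewrite [LHS](eq_bigr (fun tau : traj S A H => traj_prob M pi tau * (tau t == (s, a))%:R)); last first.
  by move=> tau _; case: eqP; rewrite ?mulr1 ?mulr0.
rewrite (sum_traj_prob_at (s, a) t (fun x => (x == (s, a))%:R))// pair_big /=.
rewrite (bigD1 (s, a)) //= eqxx mulr1 big1 ?addr0// => -[s' a'] /= /negPf ->.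
by rewrite mulr0.
Qed.

Lemma valueE H (x0 : 'I_S * 'I_A) (M : mdp R S A H) (pi : policy R S A H) :
  (forall s a, \sum_s' trans M s a s' = 1) -> (forall t s, \sum_a pi t s a = 1) ->
  value M pi = \sum_(t < H) \sum_s \sum_a state_law M pi t s * pi t s a * rew M t s a.
Proof.
move=> P1 pi1; rewrite /value; under eq_bigr do rewrite big_distrr.
rewrite exchange_big; apply: eq_bigr => t _ /=.
exact: (sum_traj_prob_at x0 t (fun x => rew M t x.1 x.2)).
Qed.

End Marginals.

(** * Auxiliary sums, a damped recursion and the optimal value *)

Lemma sum_mul_eq (R : nzRingType) (I : finType) (c : I) (f : I -> R) :
  \sum_i f i * (i == c)%:R = f c.
Proof.
rewrite (bigD1 c) //= eqxx mulr1 big1 ?addr0 // => i /negPf ->.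
by rewrite mulr0.
Qed.

Lemma sum_mul_move (R : comNzRingType) (I : finType) (c d : I) (f m : I -> R) :
  \sum_i f i * (m i * (i == c)%:R + (1 - m i) * (i == d)%:R) =
  f c * m c + f d * (1 - m d).
Proof.
under eq_bigr do rewrite mulrDr !mulrA.
by rewrite big_split /= !(sum_mul_eq _ (fun i => _ i * _)).
Qed.

(** Each contribution [z k] is damped by 1 - a per step, and at most t dampings cost at most a t, as
    in Bernoulli's inequality. *)
Lemma discounted_accumulation (R : realDomainType) (y z : nat -> R) (a : R) (n : nat) :
  0 <= a -> a * n%:R <= 1 -> 0 <= y 0%N ->
  (forall k, (k < n)%N -> 0 <= z k /\ (1 - a) * y k + z k <= y k.+1) ->
  forall t, (t <= n)%N -> (1 - a * t%:R) * \sum_(k < t) z k <= y t.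
Proof.
move=> a0 an y0 step; elim=> [|t IH] tn; first by rewrite big_ord0 mulr0.
have [zt le_y] := step _ tn.
have := IH (ltnW tn); rewrite big_ord_recr /=; set Z := \sum_(_ < _) _ => IHt.
have Z0 : 0 <= Z by apply: sumr_ge0 => k _; case: (step k (ltn_trans (ltn_ord k) tn)).
have a1 : a * t.+1%:R <= 1.
  by apply: le_trans an; rewrite ler_wpM2l// ler_nat.
have t0 : 0 <= t%:R :> R by [].
rewrite -natr1 in a1 *.
have at0 : 0 <= a * t%:R by rewrite mulr_ge0.
have a1' : 0 <= 1 - a by lra.
have := ler_wpM2l a1' IHt => h1.
have : 0 <= a * t%:R * (a * Z) by rewrite !mulr_ge0.
have : 0 <= a * t%:R * z t by rewrite !mulr_ge0.
have : 0 <= a * z t by rewrite !mulr_ge0.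
lra.
Qed.

(** A real [sup] bounds its set only if the set is bounded; here every value is at most H times the
    number of trajectories. *)
Lemma value_le_opt (R : realType) (S A H : nat) (M : mdp R S A H) (pi : policy R S A H) :
  valid_mdp M -> valid_policy pi -> value M pi <= opt_value M.
Proof.
move=> [[nu0 nu1] [trP rewP]] vpi; apply: ub_le_sup; last by exists pi.
have le1 m (p : 'I_m -> R) i : prob_vec p -> p i <= 1.
  by move=> [p0 <-]; rewrite (bigD1 i) //= lerDl sumr_ge0.
exists (\sum_(tau : traj S A H) \sum_(t < H) 1) => _ [pi' [vpi' ->]].
have fac01 tau t : 0 <= state_factor M tau t * pi' t (tau t).1 (tau t).2 <= 1.
  have /andP[f0 f1] : 0 <= state_factor M tau t <= 1.
    rewrite /state_factor; case: Defs.prev => [u|].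
      by case: (trP (tau u).1 (tau u).2) => /[dup] ? -> ?; rewrite le1.
    by rewrite nu0 le1.
  have [p0 _] := vpi' t (tau t).1.
  by rewrite mulr_ge0//= mulr_ile1// le1//; exact: vpi'.
apply: ler_sum => tau _; apply: (@le_trans _ _ (1 * \sum_(t < H) 1)); last by rewrite mul1r.
apply: ler_pM.
- by apply: prodr_ge0 => t _; case/andP: (fac01 tau t).
- by apply: sumr_ge0 => t _; case/andP: (rewP t (tau t).1 (tau t).2).
- by apply: Num.Theory.prodr_ile1 => t _; exact: fac01.
- by apply: ler_sum => t _; case/andP: (rewP t (tau t).1 (tau t).2).
Qed.

(** * The hard instances *)

Section Pairing.
Variable S : nat.
Implicit Type s : 'I_S.

(* States 2k and 2k+1 form a pair; when [S] is odd the last state is its own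
   partner, since [insubd s] falls back on [s]. *)
Definition partner s : 'I_S := if odd s then insubd s s.-1 else insubd s s.+1.

(** The unpaired last state of an odd [S] is neither low nor odd: it carries no bit and no
    reward. *)
Definition low s : bool := ~~ odd s && (s.+1 < S)%N.

Lemma val_partner s :
  val (partner s) = if odd s then s.-1 else if (s.+1 < S)%N then s.+1 else s.
Proof.
rewrite /partner; case: ifP => os; rewrite val_insubd //.
by rewrite (leq_ltn_trans (leq_pred _) (ltn_ord s)).
Qed.

Lemma partnerK : involutive partner.
Proof.
move=> s; apply/val_inj; rewrite val_partner /= val_partner.
have := ltn_ord s; case: (boolP (odd s)) => os sS.
  have -> : odd s.-1 = false by move: os; case: (nat_of_ord s) => //= k /negPf.
  have -> : s.-1.+1 = s by case: (nat_of_ord s) os.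
  by rewrite sS.
by case sS': (s.+1 < S)%N => /=; rewrite ?os ?(negPf os) //= sS'.
Qed.

Lemma partner_eq s s' : (partner s == s') = (s == partner s').
Proof. by apply/eqP/eqP => [<-|->]; rewrite partnerK. Qed.

Lemma low_partner s : low (partner s) = odd s.
Proof.
rewrite /low val_partner; have := ltn_ord s; case: (boolP (odd s)) => os sS.
  have -> : odd s.-1 = false by move: os; case: (nat_of_ord s) => //= k /negPf.
  have -> : s.-1.+1 = s by case: (nat_of_ord s) os.
  by rewrite sS.
by case sS': (s.+1 < S)%N => /=; rewrite ?os ?(negPf os) //= sS'.
Qed.

Lemma odd_partner s : odd (partner s) = low s.
Proof. by rewrite -low_partner partnerK. Qed.

Lemma partner_neq s : low s -> partner s != s.
Proof.
rewrite -odd_partner => os; apply/eqP => e; move: (os).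
by rewrite -low_partner partnerK /low -{1}e os.
Qed.

Lemma card_low : (S./2 <= #|[pred s | low s]|)%N.
Proof.
have lt_double (k : 'I_S./2) : (k.*2.+1 < S)%N by have := ltn_ord k; lia.
pose f (k : 'I_S./2) : 'I_S := Ordinal (ltnW (lt_double k)).
rewrite -[leqLHS]card_ord -(card_imset predT (f := f)); last first.
  by move=> k l /(congr1 val) /= /double_inj /val_inj.
apply: subset_leq_card; apply/fintype.subsetP => s /imsetP[k _ ->].
by rewrite inE /low /= odd_double lt_double.
Qed.

End Pairing.

Section HardInstance.
Variables (R : realType) (S A H : nat) (delta : R).
Implicit Types (b : {ffun 'I_S -> bool}) (s : 'I_S) (a : 'I_A).
Implicit Type pi : policy R S A H.

Definition contrast a : R := (a == 0 :> nat)%:R - (a == 1 :> nat)%:R.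

(* The hidden bit [b s] decides which of the actions 0 and 1 raises the
   probability of leaving a low (unrewarded) state and which lowers it. *)
Definition bit_sign b s : R := if low s then (-1) ^+ b s else 0.

Definition rate b s a : R :=
  (4 * H%:R)^-1 * (1 + delta * (bit_sign b s * contrast a)).

Definition hard_mdp b : mdp R S A H :=
  MDP (fun=> S%:R^-1)
      (fun s a s' => rate b s a * (s' == partner s)%:R + (1 - rate b s a) * (s' == s)%:R)
      (fun _ s _ => (odd s)%:R).

(* Actions 0 and 1 get the same mass [q], so the perturbations cancel in the
   averaged chain; the surplus mass goes to the uninformative action 2. *)
Definition behavior (q : R) : policy R S A H :=
  fun _ _ a => q + (a == 2 :> nat)%:R * (1 - A%:R * q).

(** The action numbered by the bit is the one that raises the swap rate in a low state. This policy
    serves as a comparison, so its optimality is never shown. *)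
Definition greedy b : policy R S A H := fun _ s a => (a == b s :> nat)%:R.

Definition tilt pi (t : nat) s : R := \sum_a extend_policy pi t s a * contrast a.

Definition mean_rate b pi t s : R :=
  (4 * H%:R)^-1 * (1 + delta * (bit_sign b s * tilt pi t s)).

Hypotheses (S_gt0 : (0 < S)%N) (A_gt2 : (2 < A)%N) (H_gt1 : (1 < H)%N).
Hypotheses (delta_ge0 : 0 <= delta) (delta_le : delta <= 2^-1).

Let a0 : 'I_A := Ordinal (ltn_trans (ltnSn 0) (ltn_trans (ltnSn 1) A_gt2)).
Let a1 : 'I_A := Ordinal (ltn_trans (ltnSn 1) A_gt2).
Let a2 : 'I_A := Ordinal A_gt2.
Let s0 : 'I_S := Ordinal S_gt0.

Lemma step_gt0 : 0 < (4 * H%:R)^-1 :> R.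
Proof. by rewrite invr_gt0 mulr_gt0// ltr0n ltnW. Qed.

Lemma step_mul : (4 * H%:R)^-1 * H%:R = 4^-1 :> R.
Proof. by rewrite invfM mulrVK ?unitfE ?pnatr_eq0 -?lt0n 1?ltnW. Qed.

Lemma step_le : (4 * H%:R)^-1 <= 8^-1 :> R.
Proof.
rewrite lef_pV2 ?posrE ?mulr_gt0 ?ltr0n ?(ltnW H_gt1)//.
have : 2 <= H%:R :> R by rewrite ler_nat.
by lra.
Qed.

Lemma contrast_norm a : `|contrast a| <= 1.
Proof.
by rewrite /contrast; case: a => -[|[|k]] ? /=; rewrite ?subr0 ?sub0r ?normrN ?normr1 ?normr0.
Qed.

Lemma bit_sign_norm b s : `|bit_sign b s| <= 1.
Proof. by rewrite /bit_sign; case: ifP; rewrite ?normr0// normrX normrN1 expr1n. Qed.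

Lemma sum_contrast (f : 'I_A -> R) : \sum_a f a * contrast a = f a0 - f a1.
Proof.
rewrite /contrast; under eq_bigr do rewrite mulrBr.
by rewrite sumrB -(sum_mul_eq a0) -(sum_mul_eq a1).
Qed.

Lemma tilt_norm pi t s : valid_policy pi -> `|tilt pi t s| <= 1.
Proof.
move=> vpi; rewrite /tilt /extend_policy; case: insubP => [u _ _|_]; last first.
  by rewrite big1 ?normr0// => a _; rewrite mul0r.
have [p0 p1] := vpi u s; rewrite -p1.
apply: (le_trans (ler_norm_sum _ _ _)); apply: ler_sum => a _.
by rewrite normrM (ger0_norm (p0 a)) ler_piMr ?contrast_norm.
Qed.

(** As delta is at most 1/2, the perturbing factor lies between 1/2 and 3/2. *)
Lemma rate_itv (x y : R) : `|x| <= 1 -> `|y| <= 1 ->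
  (8 * H%:R)^-1 <= (4 * H%:R)^-1 * (1 + delta * (x * y)) <= 2 * (4 * H%:R)^-1.
Proof.
move=> x1 y1; have : `|x * y| <= 1 by rewrite normrM mulr_ile1.
rewrite ler_norml => /andP[lo hi].
have -> : (8 * H%:R)^-1 = (4 * H%:R)^-1 * 2^-1 :> R.
  by rewrite -invfM; congr (_^-1); ring.
have := step_gt0; set e : R := (4 * _)^-1 => e0; apply/andP; split.
  by rewrite ler_pM2l//; have := ler_wpM2l delta_ge0 lo; have := delta_le; lra.
by rewrite mulrC ler_pM2r//; have := ler_wpM2l delta_ge0 hi; have := delta_le; lra.
Qed.

Lemma rate_bounds b s a : (8 * H%:R)^-1 <= rate b s a <= 4^-1.
Proof.
have /andP[-> /le_trans] := rate_itv (bit_sign_norm b s) (contrast_norm a); apply.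
have := step_le; lra.
Qed.

Lemma rate_gt0 b s a : 0 < rate b s a.
Proof.
have /andP[+ _] := rate_bounds b s a; apply: lt_le_trans.
by rewrite invr_gt0 mulr_gt0// ltr0n ltnW.
Qed.

Lemma mean_rate_itv b pi t s : valid_policy pi ->
  0 <= mean_rate b pi t s <= 2 * (4 * H%:R)^-1.
Proof.
move=> vpi; have /andP[lo ->] := rate_itv (bit_sign_norm b s) (tilt_norm t s vpi).
by rewrite andbT; apply: le_trans lo; rewrite invr_ge0 mulr_ge0.
Qed.

Lemma sum_trans_hard b s a (f : 'I_S -> R) :
  \sum_s' trans (hard_mdp b) s a s' * f s' =
  rate b s a * f (partner s) + (1 - rate b s a) * f s.
Proof.
rewrite /=; under eq_bigr do rewrite mulrDl [X in X + _]mulrAC [X in _ + X]mulrAC.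
by rewrite big_split /= !sum_mul_eq.
Qed.

Lemma sum_trans_hard1 b s a : \sum_s' trans (hard_mdp b) s a s' = 1.
Proof.
have := sum_trans_hard b s a (fun=> 1); under eq_bigr do rewrite mulr1.
by move=> ->; ring.
Qed.

Lemma valid_hard b : valid_mdp (hard_mdp b).
Proof.
split; first split => [i|]; first by rewrite /= invr_ge0.
  by rewrite /= sumr_const card_ord -[_ *+ S]mulr_natr mulVf// pnatr_eq0 -lt0n.
split=> [s a|t s a]; last by rewrite /= ler0n lern1 leq_b1.
split; last exact: sum_trans_hard1.
move=> s' /=; have := rate_gt0 b s a; have /andP[_ r1] := rate_bounds b s a.
move=> r0; apply: addr_ge0; apply: mulr_ge0 => //; first exact: ltW.
by rewrite subr_ge0 (le_trans r1)//; lra.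
Qed.

(** Rates are affine in the contrast, so a policy enters the state dynamics only through its
    [tilt]. *)
Lemma hard_lawS b pi (t : nat) s : valid_policy pi -> (t < H)%N ->
  state_law (hard_mdp b) pi t.+1 s =
  state_law (hard_mdp b) pi t (partner s) * mean_rate b pi t (partner s) +
  state_law (hard_mdp b) pi t s * (1 - mean_rate b pi t s).
Proof.
move=> vpi tH; rewrite -[t]/(val (Ordinal tH)) state_lawS; set u := Ordinal tH.
set L := state_law _ _.
rewrite -sum_mul_move; apply: eq_bigr => s' _; congr (_ * _).
have [_ p1] := vpi u s'.
rewrite /= (eq_sym s) partner_eq (eq_sym s).
  have -> : mean_rate b pi u s' = \sum_a pi u s' a * rate b s' a.
    rewrite /mean_rate /tilt extend_policy_ord /rate.
    under [RHS]eq_bigr do rewrite mulrCA mulrDr mulr1 2!(mulrCA (pi _ _ _)).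
    by rewrite -mulr_sumr big_split /= p1 -!mulr_sumr.
  have -> : 1 - \sum_a pi u s' a * rate b s' a = \sum_a pi u s' a * (1 - rate b s' a).
    by under [RHS]eq_bigr do rewrite mulrBr mulr1; rewrite sumrB p1.
  rewrite !mulr_suml -big_split /=; apply: eq_bigr => a _; ring.
Qed.

Lemma hard_law_ge0 b pi t s : valid_policy pi -> (t <= H)%N ->
  0 <= state_law (hard_mdp b) pi t s.
Proof.
move=> vpi; elim: t s => [|t IH] s tH; first by rewrite state_law0 invr_ge0.
rewrite hard_lawS// addr_ge0// mulr_ge0 ?IH 1?ltnW//.
  by case/andP: (mean_rate_itv b t (partner s) vpi).
by have /andP[_] := mean_rate_itv b t s vpi; have := step_le; lra.
Qed.

(** Mass moves only within a pair, so each pair keeps its initial mass. *)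
Lemma hard_law_pair b pi t s : valid_policy pi -> (t <= H)%N ->
  state_law (hard_mdp b) pi t s + state_law (hard_mdp b) pi t (partner s) = 2 * S%:R^-1.
Proof.
move=> vpi; elim: t => [|t IH] tH; first by rewrite !state_law0 /=; ring.
by rewrite -(IH (ltnW tH)) !hard_lawS// partnerK; ring.
Qed.

Lemma hard_law_ge b pi t s : valid_policy pi -> (t <= H)%N ->
  (2 * S%:R)^-1 <= state_law (hard_mdp b) pi t s.
Proof.
move=> vpi; set e : R := (4 * H%:R)^-1.
(* A state loses at most the fraction 2e = 1/(2H) of its mass per step, hence at most half of it
   over the episode. *)
suff h : (t <= H)%N -> S%:R^-1 * (1 - 2 * e * t%:R) <= state_law (hard_mdp b) pi t s.
  move=> tH; apply: le_trans (h tH).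
  have : e * t%:R <= 4^-1 by rewrite -step_mul ler_wpM2l ?ler_nat// ltW// step_gt0.
  have -> : (2 * S%:R)^-1 = S%:R^-1 * 2^-1 :> R by rewrite invfM mulrC.
  by move=> et; rewrite ler_wpM2l ?invr_ge0//; lra.
elim: t => [|t IH] tH; first by rewrite state_law0 mulr0 subr0 mulr1.
rewrite hard_lawS//; have := IH (ltnW tH); set L := state_law _ _ => IHt.
have L0 s' : 0 <= L t s' by apply: hard_law_ge0 => //; exact: ltnW.
have /andP[m0 _] := mean_rate_itv b t (partner s) vpi.
have /andP[_ m1] := mean_rate_itv b t s vpi.
have e0 : 0 <= e by rewrite ltW// step_gt0.
have e1 : e <= 8^-1 := step_le.
have h1 := mulr_ge0 (L0 (partner s)) m0.
have h2 : L t s * (1 - 2 * e) <= L t s * (1 - mean_rate b pi t s).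
  by rewrite ler_wpM2l// lerD2l lerN2.
have h3 : S%:R^-1 * (1 - 2 * e * t%:R) * (1 - 2 * e) <= L t s * (1 - 2 * e).
  by rewrite ler_wpM2r//; lra.
have h4 : 0 <= S%:R^-1 * (e * t%:R * e) :> R by rewrite !mulr_ge0 ?invr_ge0.
rewrite -[t.+1]addn1 natrD; nra.
Qed.

Lemma valid_greedy b : valid_policy (greedy b).
Proof.
move=> t s; split=> [a|]; first by rewrite ler0n.
have lt2 : (b s < A)%N by apply: leq_ltn_trans (leq_b1 _) _; exact: ltn_trans A_gt2.
by rewrite /greedy -[RHS](sum_mul_eq (Ordinal lt2) (fun=> 1)); under [RHS]eq_bigr do rewrite mul1r.
Qed.

Lemma tilt_greedy b (t : 'I_H) s : low s -> bit_sign b s * tilt (greedy b) t s = 1.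
Proof.
move=> ls; rewrite /bit_sign ls /tilt extend_policy_ord sum_contrast /greedy /=.
by case: (b s); rewrite /= ?expr1 ?expr0; ring.
Qed.

(** The lead of [greedy b] in the high state obeys a damped linear recursion, fed at each step by
    the mismatch times the mass of the low state, which is at least 1/(2S). *)
Lemma hard_law_gap b pi t s : valid_policy pi -> low s -> (t <= H)%N ->
  delta / (32 * H%:R * S%:R) * \sum_(k < t) (1 - bit_sign b s * tilt pi k s) <=
  state_law (hard_mdp b) (greedy b) t (partner s) - state_law (hard_mdp b) pi t (partner s).
Proof.
move=> vpi ls tH.
have vg := valid_greedy b.
pose y t := state_law (hard_mdp b) (greedy b) t (partner s) -
            state_law (hard_mdp b) pi t (partner s).
set e : R := (4 * H%:R)^-1.
have e0 : 0 < e := step_gt0.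
pose z k := e * delta * (2 * S%:R)^-1 * (1 - bit_sign b s * tilt pi k s).
have w1 k : 0 <= 1 - bit_sign b s * tilt pi k s.
  rewrite subr_ge0 (le_trans (ler_norm _))// normrM mulr_ile1 ?bit_sign_norm//.
  exact: tilt_norm.
have pl : bit_sign b (partner s) = 0 by rewrite /bit_sign low_partner; case/andP: ls => /negPf ->.
(* With x, x' the masses of the rewarded state under [pi] and [greedy b], the
   low state carries 2/S - x resp. 2/S - x'; subtract the two recursions. *)
have stepE k : (k < H)%N ->
    y k.+1 = y k * (1 - e * (2 + delta)) +
      e * delta * state_law (hard_mdp b) pi k s * (1 - bit_sign b s * tilt pi k s).
  move=> kH; have := hard_law_pair b s vg (ltnW kH); have := hard_law_pair b s vpi (ltnW kH).
  rewrite /y !hard_lawS// partnerK /mean_rate pl !mul0r mulr0 addr0 mulr1.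
  rewrite (tilt_greedy b (Ordinal kH) ls) -/e.
  set x := state_law _ _ _ (partner s); set x' := state_law _ (greedy b) _ (partner s).
  move=> /(canRL (addrK _)) -> /(canRL (addrK _)) ->; ring.
have y_ge0 k : (k <= H)%N -> 0 <= y k.
  elim: k => [|k IH] kH; first by rewrite /y !state_law0 subrr.
  rewrite stepE// addr_ge0 ?mulr_ge0 ?IH ?hard_law_ge0 1?ltnW//.
    by have := ler_wpM2l (ltW e0) delta_le; have : e <= 8^-1 := step_le; lra.
  exact: ltW.
(* The true damping is e(2 + delta), below 3e; over H steps this totals 3/4 and leaves the factor
   1/4. *)
have acc := @discounted_accumulation _ y z (3 * e) H _ _ _ _ t tH.
have e_ge0 : 0 <= e := ltW e0.
have S2_ge0 : 0 <= (2 * S%:R)^-1 :> R by rewrite invr_ge0 mulr_ge0.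
have e34 : 3 * e * H%:R = 3 / 4 by rewrite -mulrA step_mul.
apply: (le_trans _ (acc _ _ _ _)).
- rewrite /z -mulr_sumr mulrA; apply: ler_wpM2r; first exact: sumr_ge0.
  have -> : delta / (32 * H%:R * S%:R) = 4^-1 * (e * delta * (2 * S%:R)^-1).
    have Sn0 : S%:R != 0 :> R by rewrite pnatr_eq0 -lt0n.
    have Hn0 : H%:R != 0 :> R by rewrite pnatr_eq0 -lt0n ltnW.
    by rewrite /e; field; rewrite Sn0 Hn0.
  rewrite ler_wpM2r ?mulr_ge0//.
  have : 3 * e * t%:R <= 3 * e * H%:R by rewrite ler_wpM2l ?mulr_ge0// ler_nat.
  by rewrite e34; lra.
- by rewrite mulr_ge0.
- by rewrite e34; lra.
- exact: y_ge0.
- move=> k kH; split; first by rewrite !mulr_ge0.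
  rewrite stepE// [X in X + _]mulrC; apply: lerD.
    rewrite ler_wpM2l ?y_ge0 1?ltnW//.
    by have := ler_wpM2l (ltW e0) delta_le; lra.
  rewrite /z ler_wpM2r// ler_wpM2l ?mulr_ge0//.
  exact: hard_law_ge (ltnW kH).
Qed.

(** Reindexing by [partner] turns the sum over rewarded states into one over low states, where the
    bits live. *)
Lemma hard_value b pi : valid_policy pi ->
  value (hard_mdp b) pi =
  \sum_(s | low s) \sum_(t < H) state_law (hard_mdp b) pi t (partner s).
Proof.
move=> vpi; rewrite (valueE (s0, a0)); last 2 first.
- exact: sum_trans_hard1.
- by move=> t s; case: (vpi t s).
rewrite [RHS]exchange_big; apply: eq_bigr => t _ /=.
rewrite (reindex_inj (inv_inj (@partnerK S))) [RHS]big_mkcond; apply: eq_bigr => s _ /=.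
rewrite -mulr_suml odd_partner -mulr_sumr; case: (vpi t (partner s)) => _ ->.
by case: low; rewrite ?mulr0 ?mulr1.
Qed.

(** The optimal value is at least the greedy one, and the gap of order delta/(HS) is collected in at
    least H/2 steps. *)
Lemma regret_ge b pi : valid_policy pi ->
  delta / (64 * S%:R) *
    \sum_(s | low s) \sum_(k < H./2) (1 - bit_sign b s * tilt pi k s) <=
  opt_value (hard_mdp b) - value (hard_mdp b) pi.
Proof.
move=> vpi; have vg := valid_greedy b.
apply: (@le_trans _ _ (value (hard_mdp b) (greedy b) - value (hard_mdp b) pi)); last first.
  by rewrite lerD2r value_le_opt//; exact: valid_hard.
rewrite !hard_value// -sumrB mulr_sumr; apply: ler_sum => s ls.
rewrite -sumrB; set c := delta / (32 * H%:R * S%:R); set W := \sum_(_ < _) _.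
have Sn0 : S%:R != 0 :> R by rewrite pnatr_eq0 -lt0n.
have Hn0 : H%:R != 0 :> R by rewrite pnatr_eq0 -lt0n ltnW.
have c0 : 0 <= c by rewrite mulr_ge0// invr_ge0 !mulr_ge0.
have w0 k : 0 <= 1 - bit_sign b s * tilt pi k s.
  rewrite subr_ge0 (le_trans (ler_norm _))// normrM mulr_ile1 ?bit_sign_norm//.
  exact: tilt_norm.
have W0 : 0 <= W by apply: sumr_ge0.
have count (n h : nat) : (\sum_(t < n) (h <= t) = n - h)%N.
  elim: n => [|n IH]; first by rewrite big_ord0.
  by rewrite big_ord_recr /= IH; lia.
(* Mismatches made before H/2 are still felt at every step after H/2. *)
apply: (@le_trans _ _ (\sum_(t < H) (H./2 <= t)%:R * (c * W))).
  rewrite -mulr_suml -natr_sum count.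
  have -> : delta / (64 * S%:R) * W = H%:R / 2 * (c * W).
    by rewrite /c; field; rewrite Sn0 Hn0.
  rewrite ler_wpM2r ?mulr_ge0// ler_pdivrMr// -natrM ler_nat; lia.
apply: ler_sum => t _; have tH := ltn_ord t.
apply: le_trans (hard_law_gap b vpi ls (ltnW tH)); rewrite -/c.
case: leqP => ht; last by rewrite mul0r mulr_ge0// sumr_ge0.
rewrite mul1r ler_wpM2l// /W -!(big_mkord xpredT (fun k => 1 - bit_sign b s * tilt pi k s)).
by rewrite (big_cat_nat (leq0n _) ht) /= lerDl sumr_ge0.
Qed.

(** * The behavior policy on a hard instance *)

Section Behavior.
Variable q : R.
Hypotheses (q_ge0 : 0 <= q) (q_le : A%:R * q <= 1).

Lemma behavior_ge t s a : q <= behavior q t s a.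
Proof. by rewrite lerDl mulr_ge0// subr_ge0. Qed.

Lemma valid_behavior : valid_policy (behavior q).
Proof.
move=> t s; split=> [a|]; first exact: le_trans (behavior_ge t s a).
rewrite big_split /= sumr_const card_ord -mulr_suml.
have -> : \sum_(a < A) (a == 2 :> nat)%:R = 1 :> R.
  by rewrite -[RHS](sum_mul_eq a2 (fun=> 1)); under [RHS]eq_bigr do rewrite mul1r.
by rewrite mul1r mulr_natl addrC subrK.
Qed.

(** Equal masses on actions 0 and 1 make the tilt vanish, so all swap rates coincide and the uniform
    law is preserved. *)
Lemma hard_law_behavior b t s : (t <= H)%N ->
  state_law (hard_mdp b) (behavior q) t s = S%:R^-1.
Proof.
have vb := valid_behavior.
have m0 k s' : (k < H)%N -> mean_rate b (behavior q) k s' = (4 * H%:R)^-1.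
  move=> kH; rewrite /mean_rate /tilt sum_contrast.
  rewrite -[k]/(val (Ordinal kH)) extend_policy_ord /behavior /=.
  by ring.
elim: t s => [|t IH] s tH; first by rewrite state_law0.
by rewrite hard_lawS// !IH 1?ltnW// !m0//; ring.
Qed.

Lemma occupancy_behavior_ge b t s a :
  q / S%:R <= occupancy (hard_mdp b) (behavior q) t s a.
Proof.
rewrite occupancyE; last 2 first.
- exact: sum_trans_hard1.
- by move=> t' s'; case: (valid_behavior t' s').
rewrite hard_law_behavior 1?ltnW// mulrC ler_wpM2l ?invr_ge0//; exact: behavior_ge.
Qed.

End Behavior.

End HardInstance.

(** * Indistinguishability of instances differing in one bit *)

Lemma expr_1D_le (R : realFieldType) (x : R) (n : nat) :
  0 <= x -> n%:R * x <= 2^-1 -> (1 + x) ^+ n <= 1 + 2 * n%:R * x.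
Proof.
move=> x0; elim: n => [|n IH] nx; first by rewrite expr0 mulr0 mul0r addr0.
rewrite -natr1 in nx *.
have n0 : 0 <= n%:R :> R by [].
have nx0 : 0 <= n%:R * x by rewrite mulr_ge0.
have nx1 : n%:R * x <= 2^-1 by lra.
have x1 : 0 <= 1 + x by lra.
rewrite exprSr; apply: (le_trans (ler_wpM2r x1 (IH nx1))).
have := ler_wpM2r x0 nx1; lra.
Qed.

(* Summed over a sample space this bounds the difference of two expectations
   by (1 + chi^2) / 2. *)
Lemma change_of_measure (R : realFieldType) (p q w : R) :
  0 <= q -> (q = 0 -> p = 0) -> `|w| <= 1 ->
  (p - q) * w <= 2^-1 * (p ^+ 2 / q) - p + q.
Proof.
move=> q0 pq w1; have [q_eq0|qn0] := eqVneq q 0.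
  by rewrite q_eq0 pq//; rewrite !subr0 mul0r expr0n mul0r mulr0 addr0.
have -> : p = p / q * q by rewrite divfK.
set u := p / q.
have -> : (u * q) ^+ 2 / q = u ^+ 2 * q by field.
have w2 : w ^+ 2 <= 1 by rewrite -real_normK ?num_real// expr_le1.
(* Young's inequality (u - 1) w <= ((u - 1)^2 + w^2) / 2, weighted by q. *)
have h1 : 0 <= q * (u - 1 - w) ^+ 2 by rewrite mulr_ge0// sqr_ge0.
have h2 : 0 <= q * (1 - w ^+ 2) by rewrite mulr_ge0// subr_ge0.
nra.
Qed.

Section TiltedMdp.
Variables (R : realType) (S A H n : nat).
Implicit Types (M : mdp R S A H) (pi : policy R S A H).

(* The transitions are not stochastic: the sum of [traj_prob] over all
   trajectories is 1 + chi^2 of the laws under [M] and [M'] (0 / 0 = 0 here). *)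
Definition tilted_mdp M M' : mdp R S A H :=
  MDP (init M) (fun s a s' => trans M s a s' ^+ 2 / trans M' s a s') (rew M).

Lemma sqr_divf (x : R) : x ^+ 2 / x = x.
Proof.
by have [->|x0] := eqVneq x 0; rewrite ?expr0n ?mul0r// expr2 mulfK.
Qed.

(** The ratio factorises over steps; the initial and policy factors are common to both laws, and x^2
    / x = x also at 0. *)
Lemma traj_prob_tilted M M' pi tau : init M = init M' ->
  traj_prob M pi tau ^+ 2 / traj_prob M' pi tau = traj_prob (tilted_mdp M M') pi tau.
Proof.
move=> eq_init; rewrite /traj_prob -prodrXl -prodfV -big_split /=.
apply: eq_bigr => t _; rewrite exprMn invfM mulrACA sqr_divf; congr (_ * _).
rewrite /state_factor; case: Defs.prev => [u|] //=.
by rewrite -eq_init sqr_divf.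
Qed.

(** Episodes are independent, so 1 + chi^2 is multiplicative over them. *)
Lemma sum_data_prob_tilted M M' pi : init M = init M' ->
  \sum_(D : {ffun 'I_n -> traj S A H}) data_prob M pi D ^+ 2 / data_prob M' pi D =
  (\sum_(tau : traj S A H) traj_prob (tilted_mdp M M') pi tau) ^+ n.
Proof.
move=> eq_init; rewrite -[in RHS](card_ord n) -prodr_const.
rewrite [RHS](bigA_distr_bigA (fun (_ : 'I_n) tau => traj_prob (tilted_mdp M M') pi tau)).
apply: eq_bigr => D _; rewrite /data_prob -prodrXl -prodfV -big_split /=.
by apply: eq_bigr => i _; rewrite traj_prob_tilted.
Qed.

Lemma sum_data_prob M pi :
  \sum_(D : {ffun 'I_n -> traj S A H}) data_prob M pi D =
  (\sum_(tau : traj S A H) traj_prob M pi tau) ^+ n.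
Proof.
by rewrite -[in RHS](card_ord n) -prodr_const [RHS]bigA_distr_bigA.
Qed.

End TiltedMdp.

Section Information.
Variables (R : realType) (S A H : nat) (delta q : R).
Hypotheses (S_gt0 : (0 < S)%N) (A_gt2 : (2 < A)%N) (H_gt1 : (1 < H)%N).
Hypotheses (delta_ge0 : 0 <= delta) (delta_le : delta <= 2^-1).
Hypotheses (q_ge0 : 0 <= q) (q_le4 : q <= 4^-1) (Aq_le1 : A%:R * q <= 1).
Implicit Types (b : {ffun 'I_S -> bool}) (s : 'I_S) (a : 'I_A).

Let hard b : mdp R S A H := hard_mdp A H delta b.
Let mu : policy R S A H := behavior q.

Definition flip (s1 : 'I_S) b : {ffun 'I_S -> bool} := [ffun s => b s (+) (s == s1)].

Lemma flipK s1 : involutive (flip s1).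
Proof. by move=> b; apply/ffunP => s; rewrite !ffunE -addbA addbb addbF. Qed.

Lemma bit_sign_flip s1 b : bit_sign R (flip s1 b) s1 = - bit_sign R b s1.
Proof.
rewrite /bit_sign ffunE eqxx addbT; case: low; rewrite ?oppr0//.
by case: (b s1); rewrite /= ?expr1 ?expr0 ?opprK.
Qed.

Lemma bit_sign_flip_sqr s1 b s :
  (bit_sign R b s - bit_sign R (flip s1 b) s) ^+ 2 <= 4 * (s == s1)%:R.
Proof.
case: eqVneq => [->|ns].
  rewrite bit_sign_flip opprK mulr1.
  have := bit_sign_norm R b s1; rewrite ler_norml => /andP[]; nra.
by rewrite /bit_sign ffunE (negPf ns) addbF subrr expr0n mulr0.
Qed.

(** All rates lie strictly between 0 and 1, so the support does not depend on the bits. This is the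
    absolute continuity that [change_of_measure] asks for. *)
Lemma trans_hard_eq0 b b' s a s' : trans (hard b') s a s' = 0 -> trans (hard b) s a s' = 0.
Proof.
have pos c : 0 < rate H delta c s a /\ 0 < 1 - rate H delta c s a.
  have /andP[_] := rate_bounds H_gt1 delta_ge0 delta_le c s a.
  split; last by lra.
  exact: rate_gt0.
have [r0 r1] := pos b'; rewrite /=.
case: (s' == partner s); case: (s' == s); rewrite ?mulr1 ?mulr0 ?addr0 ?add0r// => e.
(* At an unpaired state both indicators hold and the entry is 1. *)
- by exfalso; lra.
- by rewrite e ltxx in r0.
- by rewrite e ltxx in r1.
Qed.

Lemma data_prob_eq0 n b b' (D : {ffun 'I_n -> traj S A H}) :
  data_prob (hard b') mu D = 0 -> data_prob (hard b) mu D = 0.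
Proof.
move/eqP; rewrite prodf_seq_eq0 => /hasP[i _ /=].
rewrite prodf_seq_eq0 => /hasP[t _ /=]; rewrite mulf_eq0 => zero.
apply/eqP; rewrite prodf_seq_eq0; apply/hasP; exists i; rewrite ?mem_index_enum//=.
rewrite prodf_seq_eq0; apply/hasP; exists t; rewrite ?mem_index_enum//=.
rewrite mulf_eq0; case/orP: zero => [/eqP h|->]; last by rewrite orbT.
move: h; rewrite /state_factor; case: Defs.prev => [u|] h.
  by rewrite (trans_hard_eq0 b h) eqxx.
by rewrite /= in h *; rewrite h eqxx.
Qed.

(** One-step chi^2 of two-point laws, (r - r')^2 / (r' (1 - r')): the numerator is at most (2 e
    delta contrast)^2 with e = 1/(4H), the denominator at least e/4. Since f agrees on the pair, it
    factors out. *)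
Lemma sum_tilted_trans s1 b s a (f : 'I_S -> R) : f (partner s) = f s -> 0 <= f s ->
  \sum_s' trans (tilted_mdp (hard b) (hard (flip s1 b))) s a s' * f s' <=
  f s * (1 + 4 * delta ^+ 2 / H%:R * contrast R a ^+ 2 * (s == s1)%:R).
Proof.
move=> fp f0; set b' := flip s1 b.
have c2_ge0 := sqr_ge0 (contrast R a); have d2_ge0 := sqr_ge0 delta.
(* An unpaired state stays put under every rate, so its row gains nothing. *)
have [ps|ps] := eqVneq (partner s) s.
  rewrite (eq_bigr (fun s' => f s' * (s' == s)%:R)) => [|s' _]; last first.
    rewrite /= ps -!mulrDl !(addrC _ (1 - _)) !subrK !mul1r sqr_divf; exact: mulrC.
  by rewrite sum_mul_eq ler_peMr// lerDl mulr_ge0// mulr_ge0// mulr_ge0 ?invr_ge0// mulr_ge0.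
set r := rate H delta b s a; set r' := rate H delta b' s a.
have /andP[rlo rhi] : (8 * H%:R)^-1 <= r' <= 4^-1 := rate_bounds H_gt1 delta_ge0 delta_le b' s a.
have r'0 : 0 < r' := rate_gt0 H_gt1 delta_ge0 delta_le b' s a.
have r'1 : 0 < 1 - r' by lra.
rewrite (eq_bigr (fun s' => f s' * (r ^+ 2 / r') * (s' == partner s)%:R +
                 f s' * ((1 - r) ^+ 2 / (1 - r')) * (s' == s)%:R)); last first.
  move=> s' _; rewrite /= -/r -/r'.
  have [e|_] := eqVneq s' (partner s); have [e'|_] := eqVneq s' s;
    rewrite ?mulr1 ?mulr0 ?addr0 ?add0r.
  - by rewrite -e e' eqxx in ps.
  - exact: mulrC.
  - exact: mulrC.
  - by rewrite sqr_divf mul0r.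
rewrite big_split /= !(sum_mul_eq _ (fun s' => f s' * _)) fp -mulrDr ler_wpM2l//.
have -> : r ^+ 2 / r' + (1 - r) ^+ 2 / (1 - r') = 1 + (r - r') ^+ 2 / (r' * (1 - r')).
  by field; rewrite !gt_eqF.
rewrite lerD2l.
set e : R := (4 * H%:R)^-1.
have e0 : 0 < e := step_gt0 R H_gt1.
have -> : r - r' = e * delta * contrast R a * (bit_sign R b s - bit_sign R b' s).
  by rewrite /r /r' /rate -/e; ring.
have e8 : (8 * H%:R)^-1 = e / 2 :> R by rewrite /e -invfM; congr (_^-1); ring.
have rr' : 0 < r' * (1 - r') := mulr_gt0 r'0 r'1.
rewrite ler_pdivrMr// exprMn.
apply: (@le_trans _ _ ((e * delta * contrast R a) ^+ 2 * (4 * (s == s1)%:R))).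
  by rewrite ler_wpM2l ?sqr_ge0// bit_sign_flip_sqr.
have -> : 4 * delta ^+ 2 / H%:R = 16 * delta ^+ 2 * e.
  by rewrite /e; field; rewrite pnatr_eq0 -lt0n ltnW.
have h : e * 4^-1 <= r' * (1 - r').
  apply: (@le_trans _ _ (e / 2 * 2^-1)); first by lra.
  by apply: ler_pM => //; [rewrite mulr_ge0 1?ltW | rewrite -e8 | lra].
have : 0 <= 16 * delta ^+ 2 * e * contrast R a ^+ 2 * (s == s1)%:R.
  by rewrite mulr_ge0// mulr_ge0// mulr_ge0 ?(ltW e0)// mulr_ge0.
by move/ler_wpM2l => /(_ _ _ h); apply: le_trans; rewrite le_eqVlt; apply/orP; left; apply/eqP; field.
Qed.

(** The one-step gain 4 delta^2 / H at [s1], averaged over the behavior policy, which gives mass 2q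
    to the two informative actions. *)
Let kappa : R := 8 * delta ^+ 2 * q / H%:R.

Lemma kappa_ge0 : 0 <= kappa.
Proof. by rewrite !mulr_ge0 ?sqr_ge0 ?invr_ge0. Qed.

Lemma sum_behavior_contrast_sqr t s : \sum_a mu t s a * contrast R a ^+ 2 = 2 * q.
Proof.
have -> : \sum_a mu t s a * contrast R a ^+ 2 =
          \sum_a (mu t s a * contrast R a) * contrast R a.
  by apply: eq_bigr => a _; rewrite expr2 mulrA.
by rewrite sum_contrast /mu /behavior /contrast /=; ring.
Qed.

Lemma tilted_law_ge0 b b' t s :
  0 <= state_law (tilted_mdp (hard b) (hard b')) mu t s.
Proof.
elim: t s => [|t IH] s; first by rewrite state_law0 invr_ge0.
apply: sumr_ge0 => s' _; rewrite mulr_ge0 ?IH//; apply: sumr_ge0 => a _.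
have T0 c : 0 <= trans (hard c) s' a s.
  by have [_ [h _]] := valid_hard A S_gt0 H_gt1 delta_ge0 delta_le c; case: (h s' a).
rewrite mulr_ge0 ?mulr_ge0 ?sqr_ge0 ?invr_ge0//.
rewrite /extend_policy; case: insubP => //= u _ _.
by case: (valid_behavior A_gt2 q_ge0 Aq_le1 u s').
Qed.

(* A supersolution of the tilted backward equation: only the pair of [s1] can
   gain mass, by a factor at most 1 + kappa per step. *)
Let weight (s1 : 'I_S) k s : R :=
  1 + ((s == s1)%:R + (s == partner s1)%:R) * ((1 + kappa) ^+ k - 1).

(** Each step of the chain is traded for one more power in the weight, hence the induction on t with
    k free. At time 0 the pair has mass 2/S under the uniform law. *)
Lemma tilted_law_weight_le s1 b t k : low s1 -> (t < H)%N ->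
  \sum_s state_law (tilted_mdp (hard b) (hard (flip s1 b))) mu t s * weight s1 k s <=
  1 + 2 / S%:R * ((1 + kappa) ^+ (k + t) - 1).
Proof.
move=> ls1; have k0 := kappa_ge0.
have pk j : 1 <= (1 + kappa) ^+ j by rewrite exprn_ege1// lerDl.
elim: t k => [|t IH] k tH.
  rewrite addn0 /weight; under eq_bigr do rewrite state_law0 /= mulrDr mulrA mulr1.
  rewrite big_split /= sumr_const card_ord -[_ *+ S]mulr_natr mulVf ?pnatr_eq0 -?lt0n//.
  rewrite lerD2l -mulr_suml ler_wpM2r ?subr_ge0// -mulr_sumr mulrC ler_wpM2r ?invr_ge0//.
  rewrite big_split /=.
  have one c : \sum_i (i == c)%:R = 1 :> R.
    by rewrite -[RHS](sum_mul_eq c (fun=> 1)); under [RHS]eq_bigr do rewrite mul1r.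
  by rewrite !one.
set M := tilted_mdp _ _.
have wp s : weight s1 k (partner s) = weight s1 k s.
  by rewrite /weight !partner_eq partnerK [X in 1 + X * _]addrC.
have w1 s : 0 <= weight s1 k s.
  by rewrite addr_ge0// mulr_ge0 ?subr_ge0// addr_ge0.
rewrite addnS -addSn; apply: le_trans (IH k.+1 (ltnW tH)).
rewrite -[t]/(val (Ordinal (ltnW tH))); set u := Ordinal _.
under eq_bigr do rewrite state_lawS mulr_suml.
rewrite exchange_big /=; apply: ler_sum => s _.
under eq_bigr do rewrite -mulrA; rewrite -mulr_sumr ler_wpM2l ?tilted_law_ge0//.
under eq_bigr do rewrite mulr_suml.
rewrite exchange_big /=.
apply: (@le_trans _ _ (\sum_a mu u s a * (weight s1 k s *
    (1 + 4 * delta ^+ 2 / H%:R * contrast R a ^+ 2 * (s == s1)%:R)))).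
  apply: ler_sum => a _; under eq_bigr do rewrite -mulrA.
  rewrite -mulr_sumr ler_wpM2l//; last exact: sum_tilted_trans.
  by case: (valid_behavior A_gt2 q_ge0 Aq_le1 u s).
have -> : \sum_a mu u s a * (weight s1 k s *
    (1 + 4 * delta ^+ 2 / H%:R * contrast R a ^+ 2 * (s == s1)%:R)) =
    weight s1 k s * (1 + kappa * (s == s1)%:R).
  have [_ mu1] := valid_behavior A_gt2 q_ge0 Aq_le1 u s.
  rewrite (eq_bigr (fun a => weight s1 k s * (mu u s a) +
     weight s1 k s * (4 * delta ^+ 2 / H%:R * (s == s1)%:R) * (mu u s a * contrast R a ^+ 2))).
    rewrite big_split /= -!mulr_sumr mu1 sum_behavior_contrast_sqr /kappa.
    by field; rewrite pnatr_eq0 -lt0n ltnW.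
  by move=> a _; ring.
(* At [s1] the weight satisfies the equation exactly; everywhere else a larger exponent only
   helps. *)
rewrite /weight; have [->|_] := eqVneq s s1.
  rewrite eq_sym (negPf (partner_neq ls1)) exprSr /=.
  by rewrite le_eqVlt; apply/orP; left; apply/eqP; ring.
rewrite mulr0 addr0 mulr1 lerD2l ler_wpM2l ?addr_ge0// lerD2r.
by rewrite exprS ler_peMl ?exprn_ge0 ?addr_ge0// lerDl.
Qed.

(** The weight with k = 1 at time H - 1 gives the power H, which is linearised because H kappa = 8
    delta^2 q is at most 1/2. *)
Lemma sum_traj_tilted_le s1 b : low s1 ->
  \sum_(tau : traj S A H)
     traj_prob (tilted_mdp (hard b) (hard (flip s1 b))) mu tau <=
  1 + 32 * delta ^+ 2 * q / S%:R.
Proof.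
move=> ls1; have k0 := kappa_ge0.
have x0 : 'I_S * 'I_A := (s1, Ordinal A_gt2).
rewrite (sum_traj_prob x0) ?(ltnW H_gt1)//; last first.
  by move=> t s; case: (valid_behavior A_gt2 q_ge0 Aq_le1 t s).
have lt : (H.-1 < H)%N by rewrite prednK// ltnW.
have := @tilted_law_weight_le s1 b H.-1 1 ls1 lt.
rewrite add1n prednK ?(ltnW H_gt1)// => le1.
apply: (@le_trans _ _ (1 + 2 / S%:R * ((1 + kappa) ^+ H - 1))).
  apply: le_trans le1; apply: ler_sum => s _.
  rewrite ler_peMr ?tilted_law_ge0// lerDl mulr_ge0//.
  by rewrite expr1 addrC addKr.
have Hk : H%:R * kappa = 8 * delta ^+ 2 * q.
  by rewrite /kappa; field; rewrite pnatr_eq0 -lt0n ltnW.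
have Hk2 : H%:R * kappa <= 2^-1.
  rewrite Hk; have d2 : delta ^+ 2 <= 4^-1.
    by have := delta_ge0; have := delta_le; nra.
  have := ler_pM (sqr_ge0 delta) q_ge0 d2 q_le4; lra.
have := expr_1D_le k0 Hk2; rewrite -mulrA Hk => pow.
rewrite lerD2l; apply: (@le_trans _ _ (2 / S%:R * (2 * (8 * delta ^+ 2 * q)))).
  by rewrite ler_wpM2l ?mulr_ge0 ?invr_ge0// lerBlDl.
by rewrite le_eqVlt; apply/orP; left; apply/eqP; ring.
Qed.

Lemma sum_traj_hard b : \sum_(tau : traj S A H) traj_prob (hard b) mu tau = 1.
Proof.
have x0 : 'I_S * 'I_A := (Ordinal S_gt0, Ordinal A_gt2).
rewrite (sum_traj_prob x0) ?(ltnW H_gt1)//; last first.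
  by move=> t s; case: (valid_behavior A_gt2 q_ge0 Aq_le1 t s).
under eq_bigr do rewrite hard_law_behavior ?leq_pred//.
by rewrite sumr_const card_ord -[_ *+ S]mulr_natr mulVf// pnatr_eq0 -lt0n.
Qed.

Lemma data_prob_ge0 n b (D : {ffun 'I_n -> traj S A H}) : 0 <= data_prob (hard b) mu D.
Proof.
apply: prodr_ge0 => i _; apply: prodr_ge0 => t _.
have [[nu0 _] [tr _]] := valid_hard A S_gt0 H_gt1 delta_ge0 delta_le b.
rewrite mulr_ge0//; last by case: (valid_behavior A_gt2 q_ge0 Aq_le1 t (D i t).1).
by rewrite /state_factor; case: Defs.prev => [u|]; [case: (tr (D i u).1 (D i u).2)|].
Qed.

Lemma sum_data_prob_hard n b :
  \sum_(D : {ffun 'I_n -> traj S A H}) data_prob (hard b) mu D = 1.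
Proof. by rewrite sum_data_prob sum_traj_hard expr1n. Qed.

(** The bound on n keeps 1 + chi^2 of the whole data set below 2, and [change_of_measure] then
    yields 2/2 - 1 + 1. *)
Lemma flip_indistinguishable n s1 b (w : {ffun 'I_n -> traj S A H} -> R) :
  low s1 -> 64 * n%:R * delta ^+ 2 * q <= S%:R -> (forall D, `|w D| <= 1) ->
  \sum_D data_prob (hard b) mu D * w D -
  \sum_D data_prob (hard (flip s1 b)) mu D * w D <= 1.
Proof.
move=> ls1 nle w1; set b' := flip s1 b.
have S0 : 0 < S%:R :> R by rewrite ltr0n.
have chi : \sum_(D : {ffun 'I_n -> traj S A H})
    data_prob (hard b) mu D ^+ 2 / data_prob (hard b') mu D <= 2.
  rewrite sum_data_prob_tilted//.
  set x := 32 * delta ^+ 2 * q / S%:R.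
  have x0 : 0 <= x by rewrite !mulr_ge0 ?sqr_ge0 ?invr_ge0.
  have nx : n%:R * x <= 2^-1 by rewrite /x mulrA ler_pdivrMr//; lra.
  apply: (@le_trans _ _ ((1 + x) ^+ n)); last first.
    by apply: le_trans (expr_1D_le x0 nx) _; lra.
  apply: lerXn2r; rewrite ?nnegrE ?addr_ge0//; last exact: sum_traj_tilted_le.
  have x00 : 'I_S * 'I_A := (s1, Ordinal A_gt2).
  rewrite (sum_traj_prob x00) ?(ltnW H_gt1)//; last first.
    by move=> t s; case: (valid_behavior A_gt2 q_ge0 Aq_le1 t s).
  by apply: sumr_ge0 => s _; exact: tilted_law_ge0.
rewrite -sumrB.
apply: (@le_trans _ _ (\sum_(D : {ffun 'I_n -> traj S A H})
   (2^-1 * (data_prob (hard b) mu D ^+ 2 / data_prob (hard b') mu D)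
    - data_prob (hard b) mu D + data_prob (hard b') mu D))).
  apply: ler_sum => D _; rewrite -mulrBl change_of_measure ?data_prob_ge0//.
  exact: data_prob_eq0.
by rewrite big_split sumrB /= -mulr_sumr !sum_data_prob_hard; lra.
Qed.

End Information.

(** * Averaging over the hidden bits *)

Section Measurability.
Variables (d : measure_display) (Om : measurableType d) (R : realType).

Lemma measurable_value (S A H : nat) (M : mdp R S A H) (pol : Om -> policy R S A H) :
  (forall t s a, measurable_fun setT (fun w => pol w t s a)) ->
  measurable_fun setT (fun w => value M (pol w)).
Proof.
move=> mpol; apply: measurable_sum => tau; apply: measurable_funM => //.
apply: measurable_prod => t _; exact: measurable_funM.
Qed.

(** A bound valid for every value of the internal randomness is integrated, which reduces randomized
    algorithms to deterministic ones. *)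
Lemma le_sum_probability (Pr : probability Om R) (I : finType) (c : I -> R)
    (E : I -> set Om) (K : R) :
  (forall i, 0 <= c i) -> (forall i, measurable (E i)) ->
  (forall w, K <= \sum_i c i * (w \in E i)%:R) ->
  K <= \sum_i c i * fine (Pr (E i)).
Proof.
move=> c0 mE leK; rewrite -lee_fin -sumEFin.
have mind i : measurable_fun setT (fun w : Om => (\1_(E i) w : R)%:E).
  by apply/measurable_EFinP; exact: measurable_indic.
have -> : (\sum_i (c i * fine (Pr (E i)))%:E)%E =
          (\int[Pr]_w (\sum_i (c i)%:E * (\1_(E i) w)%:E))%E.
  rewrite ge0_integral_sum//; last 2 first.
  - by move=> i; apply: measurable_funeM.
  - by move=> i w _; rewrite -EFinM lee_fin mulr_ge0.
  apply: eq_bigr => i _; rewrite ge0_integralZl_EFin//.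
  by rewrite integral_indic// setIT EFinM fineK// fin_num_measure.
(* The comparison of integrals below is for nonnegative integrands, so a nonpositive K is treated
   apart. *)
have [K0|K0] := leP K 0.
  apply: (@le_trans _ _ 0%E); first by rewrite lee_fin.
  by apply: integral_ge0 => w _; apply: sume_ge0 => i _; rewrite -EFinM lee_fin mulr_ge0.
rewrite -[leLHS]mule1 -(@probability_setT _ _ _ Pr) -integral_cst//.
apply: ge0_le_integral => //.
- by move=> w _; rewrite lee_fin ltW.
- by apply: emeasurable_sum => i; exact: measurable_funeM.
- move=> w _; under eq_bigr do rewrite -EFinM; rewrite sumEFin lee_fin.
  exact: leK.
Qed.

End Measurability.

Section AverageFailure.
Variables (R : realType) (S A H n : nat) (delta q eps : R).
Hypotheses (S_gt0 : (0 < S)%N) (A_gt2 : (2 < A)%N) (H_gt1 : (1 < H)%N).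
Hypotheses (delta_ge0 : 0 <= delta) (delta_le : delta <= 2^-1).
Hypotheses (q_ge0 : 0 <= q) (q_le4 : q <= 4^-1) (Aq_le1 : A%:R * q <= 1).
Hypothesis few_episodes : 64 * n%:R * delta ^+ 2 * q <= S%:R.
Hypothesis eps_gt0 : 0 < eps.

Let hard b : mdp R S A H := hard_mdp A H delta b.
Let mu : policy R S A H := behavior q.
Variable pol : {ffun 'I_n -> traj S A H} -> policy R S A H.
Hypothesis valid_pol : forall D, valid_policy (pol D).

Lemma mismatch_norm b D s k : `|bit_sign R b s * tilt (pol D) k s| <= 1.
Proof. by rewrite normrM mulr_ile1 ?bit_sign_norm ?tilt_norm. Qed.

(** Instances are matched by flipping the bit of s. The sign changes, so the two mismatches add up
    to 2 minus a difference of expectations that is at most 1. *)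
Lemma average_mismatch s k : low s ->
  #|{ffun 'I_S -> bool}|%:R / 2 <=
  \sum_b \sum_D data_prob (hard b) mu D * (1 - bit_sign R b s * tilt (pol D) k s).
Proof.
move=> ls; set f := BIG_F.
have sum1 b : \sum_(D : {ffun 'I_n -> traj S A H}) data_prob (hard b) mu D = 1.
  exact: sum_data_prob_hard.
have f2 b : 1 <= f b + f (flip s b).
  rewrite /f; under eq_bigr do rewrite mulrBr mulr1.
  under [X in _ + X]eq_bigr do rewrite mulrBr mulr1.
  rewrite !sumrB !sum1.
  have := flip_indistinguishable S_gt0 A_gt2 H_gt1 delta_ge0 delta_le q_ge0 q_le4 Aq_le1
    b ls few_episodes (fun D => mismatch_norm b D s k).
  under [X in _ -> _ <= _ + (_ - X)]eq_bigr do rewrite bit_sign_flip mulNr mulrN.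
  rewrite sumrN -/mu -/(hard _); lra.
rewrite ler_pdivrMr// mulr_natr mulr2n.
rewrite [X in _ <= X + _](reindex_inj (inv_inj (flipK s))) /= -big_split /=.
rewrite -sum1_card natr_sum; apply: ler_sum => b _; rewrite addrC; exact: f2.
Qed.

Let scale : R := delta / (64 * S%:R).
(** The regret bound when every mismatch term equals 1; as the terms are at most 2, the bound never
    exceeds twice this. *)
Let gap : R := scale * (#|[pred s : 'I_S | low s]|%:R * (H./2)%:R).
Let fails b D : bool := eps <= opt_value (hard b) - value (hard b) (pol D).

Hypothesis eps_le_gap : 4 * eps <= gap.

(** Reverse Markov inequality: [g] averages at least gap/2, is at most 2 gap always, and at most eps
    <= gap/4 without failure; so failure has average probability at least 1/8. *)
Lemma average_failure :
  #|{ffun 'I_S -> bool}|%:R / 8 <=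
  \sum_b \sum_D data_prob (hard b) mu D * (fails b D)%:R.
Proof.
have gap_gt0 : 0 < gap by apply: lt_le_trans eps_le_gap; rewrite mulr_gt0.
have scale0 : 0 <= scale by rewrite mulr_ge0// invr_ge0 mulr_ge0.
pose g b D := scale * \sum_(s | low s) \sum_(k < H./2) (1 - bit_sign R b s * tilt (pol D) k s).
have g_le b D : g b D <= eps + 2 * gap * (fails b D)%:R.
  rewrite /fails; case: (leP eps (opt_value (hard b) - value (hard b) (pol D))) => h.
    rewrite /= mulr1; apply: (@le_trans _ _ (2 * gap)); last by rewrite lerDr ltW.
    rewrite /gap mulrCA ler_wpM2l// -sum1_card natr_sum mulr_suml mulr_sumr.
    apply: ler_sum => s _; rewrite mul1r -[H./2 in leRHS]card_ord -sum1_card natr_sum mulr_sumr.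
    apply: ler_sum => k _; have := mismatch_norm b D s k; rewrite ler_norml => /andP[]; lra.
  rewrite /= mulr0 addr0; apply: le_trans (ltW h).
  exact: regret_ge.
have sum1 b : \sum_(D : {ffun 'I_n -> traj S A H}) data_prob (hard b) mu D = 1.
  exact: sum_data_prob_hard.
set N : R := #|_|%:R; set X := \sum_b _.
have lower : N / 2 * gap <= \sum_b \sum_D data_prob (hard b) mu D * g b D.
  apply: (@le_trans _ _ (scale * \sum_(s | low s) \sum_(k < H./2) \sum_b \sum_D
     data_prob (hard b) mu D * (1 - bit_sign R b s * tilt (pol D) k s))).
    rewrite /gap mulrCA ler_wpM2l// mulrC -sum1_card natr_sum !mulr_suml.
    apply: ler_sum => s ls; rewrite mul1r -[H./2 in leLHS]card_ord -sum1_card natr_sum mulr_suml.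
    by apply: ler_sum => k _; rewrite mul1r average_mismatch.
  rewrite le_eqVlt; apply/orP; left; apply/eqP.
  transitivity (scale * \sum_b \sum_D \sum_(s | low s) \sum_(k < H./2)
     data_prob (hard b) mu D * (1 - bit_sign R b s * tilt (pol D) k s)).
    congr (_ * _); transitivity (\sum_(s | low s) \sum_b \sum_D \sum_(k < H./2)
       data_prob (hard b) mu D * (1 - bit_sign R b s * tilt (pol D) k s)).
      apply: eq_bigr => s _; rewrite exchange_big; apply: eq_bigr => b _; exact: exchange_big.
    rewrite exchange_big; apply: eq_bigr => b _; exact: exchange_big.
  rewrite mulr_sumr; apply: eq_bigr => b _; rewrite mulr_sumr; apply: eq_bigr => D _.
  rewrite /g mulrCA; congr (_ * _); rewrite mulr_sumr; apply: eq_bigr => s _.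
  by rewrite mulr_sumr.
have upper : \sum_b \sum_D data_prob (hard b) mu D * g b D <= N * eps + 2 * gap * X.
  rewrite /X /N -sum1_card natr_sum mulr_suml mulr_sumr -big_split /=.
  apply: ler_sum => b _; rewrite mul1r.
  have epsE : \sum_(D : {ffun 'I_n -> traj S A H}) data_prob (hard b) mu D * eps = eps.
    by rewrite -mulr_suml sum1 mul1r.
  rewrite -[X in X + _]epsE mulr_sumr -big_split /=; apply: ler_sum => D _.
  rewrite [2 * gap * _]mulrCA -mulrDr ler_wpM2l//.
  exact: data_prob_ge0.
have N0 : 0 <= N by [].
have Ne : N * eps <= N * (gap / 4) by rewrite ler_wpM2l// ler_pdivlMr// mulrC.
have : N / 4 * gap <= 2 * X * gap by lra.
by rewrite ler_pM2r//; lra.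
Qed.

End AverageFailure.

(** * Choice of constants and conclusion *)

Lemma leq_half_mul3 (k m : nat) : (1 < k)%N -> (k./2 <= m)%N -> (k <= m * 3)%N.
Proof. lia. Qed.

Theorem theorem4p2 (R : realType) :
  exists c1 c2 c p : R, 0 < c1 /\ 0 < c2 /\ 0 < c /\ 0 < p /\
  forall (S A H n : nat) (dm eps : R),
    c1 <= S%:R -> c1 <= A%:R -> c1 <= H%:R ->
    0 < dm -> dm <= ((S * A)%:R)^-1 ->
    0 < eps -> eps < c2 ->
    n%:R <= c * H%:R ^+ 2 / (dm * eps ^+ 2) ->
    forall (d : measure_display) (Om : measurableType d) (Pr : probability Om R)
      (alg : Om -> dataset R S A H n -> policy R S A H),
      (forall D t s a, measurable_fun setT (fun w => alg w D t s a)) ->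
      (forall w D, valid_policy (alg w D)) ->
      exists (M : mdp R S A H) (mu : policy R S A H),
        valid_mdp M /\ valid_policy mu /\
        (forall t s a, dm <= occupancy M mu t s a) /\
        (p%:E <= fail_prob Pr alg M mu eps)%E.
Proof.
(* 4 comes from [4 * eps], 64 from the regret bound, and each 3 from replacing a rounded half by a
   third. *)
have [K [K_gt0 KE]] : exists K : R, 0 < K /\ K = 4 * 64 * 3 * 3.
  by eexists; split; last reflexivity; rewrite !mulr_gt0.
(* In turn: A >= 4 gives q <= 1/4; eps < 1/(2K) gives delta <= 1/2; 1/(64 K^2) makes 64 n delta^2 q
   <= S; 1/8 is the average failure rate. *)
exists 4, ((2 * K)^-1), ((64 * K ^+ 2)^-1), (8^-1).
do 4![split; first by rewrite ?invr_gt0 ?mulr_gt0 ?exprn_gt0].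
move=> S A H n dm eps; rewrite !ler_nat => S4 A4 H4 dm0 dm_le eps0 eps_lt n_le.
move=> d Om Pr alg malg valg.
have S_gt1 : (1 < S)%N by lia.
have S_gt0 := ltnW S_gt1.
have A_gt2 : (2 < A)%N by lia.
have H_gt1 : (1 < H)%N by lia.
have SR : 0 < S%:R :> R by rewrite ltr0n.
have AR : 0 < A%:R :> R by rewrite ltr0n; lia.
have HR : 0 < H%:R :> R by rewrite ltr0n; lia.
have H1 : 1 <= H%:R :> R by rewrite ler1n; lia.
pose delta : R := K * eps / H%:R.
pose q : R := S%:R * dm.
have delta_ge0 : 0 <= delta by rewrite /delta !mulr_ge0 ?invr_ge0 // ltW.
have delta_le : delta <= 2^-1.
  move: eps_lt; rewrite -ltf_pV2 ?posrE ?invr_gt0 ?mulr_gt0// invrK => /ltW.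
  rewrite -[eps^-1]mul1r ler_pdivlMr// => K_le.
  by rewrite /delta ler_pdivrMr//; lra.
have q_ge0 : 0 <= q by rewrite mulr_ge0// ltW.
have Aq_le1 : A%:R * q <= 1.
  rewrite /q mulrA [A%:R * _]mulrC -natrM mulrC -ler_pdivlMr ?mul1r//.
  by rewrite natrM mulr_gt0.
have q_le4 : q <= 4^-1.
  have A4R : 4 <= A%:R :> R by rewrite ler_nat.
  have := ler_wpM2r q_ge0 A4R; lra.
have few : 64 * n%:R * delta ^+ 2 * q <= S%:R.
  move: n_le; rewrite ler_pdivlMr ?mulr_gt0 ?exprn_gt0// => n_le.
  have -> : 64 * n%:R * delta ^+ 2 * q =
    S%:R * ((64 * K ^+ 2) * (n%:R * (dm * eps ^+ 2)) / H%:R ^+ 2).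
    by rewrite /delta /q; field; rewrite gt_eqF.
  rewrite -[leRHS]mulr1 ler_wpM2l// ler_pdivrMr ?exprn_gt0// mul1r.
  rewrite mulrC -ler_pdivlMr; first by rewrite [leRHS]mulrC.
  by rewrite mulr_gt0// exprn_gt0.
have gap_ge : 4 * eps <= delta / (64 * S%:R) *
    (#|[pred s : 'I_S | low s]|%:R * (H./2)%:R).
  have L : S%:R / 3 <= #|[pred s : 'I_S | low s]|%:R :> R.
    rewrite ler_pdivrMr// -natrM ler_nat.
    exact: leq_half_mul3 S_gt1 (card_low S).
  have h : H%:R / 3 <= (H./2)%:R :> R.
    by rewrite ler_pdivrMr// -natrM ler_nat leq_half_mul3.
  have L0 : 0 <= S%:R / 3 :> R by rewrite mulr_ge0// ltW.
  have h0 : 0 <= H%:R / 3 :> R by rewrite mulr_ge0// ltW.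
  have -> : 4 * eps = delta / (64 * S%:R) * (S%:R / 3 * (H%:R / 3)).
    by rewrite /delta KE; field; rewrite !gt_eqF.
  apply: ler_wpM2l; last exact: ler_pM.
  by rewrite mulr_ge0// invr_ge0 mulr_ge0.
pose hard b : mdp R S A H := hard_mdp A H delta b.
pose mu : policy R S A H := behavior q.
(* Rewards do not depend on the bits, so [observe] is the same for all instances and any bit vector
   serves here. The algorithm thus cannot read the bits off the data format. *)
pose pol w (D : {ffun 'I_n -> traj S A H}) := alg w (observe (hard [ffun=> false]) D).
pose E b D := [set w | eps <= opt_value (hard b) - value (hard b) (pol w D)]%classic.
have mE b D : measurable (E b D).
  rewrite -[E b D]setTI; apply: measurable_fun_le => //.
  apply: measurable_funB => //; apply: measurable_value => t s a; exact: malg.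
have P_ge0 b D : 0 <= data_prob (hard b) mu D by exact: data_prob_ge0.
have failE b : fail_prob Pr alg (hard b) mu eps =
    (\sum_D data_prob (hard b) mu D * fine (Pr (E b D)))%:E.
  rewrite /fail_prob -sumEFin; apply: eq_bigr => D _.
  by rewrite EFinM fineK// fin_num_measure.
have avg : #|{ffun 'I_S -> bool}|%:R / 8 <=
    \sum_b \sum_D data_prob (hard b) mu D * fine (Pr (E b D)).
  rewrite pair_big /=.
  apply: (@le_sum_probability _ _ _ Pr _ (fun p => data_prob (hard p.1) mu p.2)
    (fun p => E p.1 p.2)) => // w.
  rewrite -(pair_big xpredT xpredT (fun b D => data_prob (hard b) mu D * (w \in E b D)%:R)) /=.
  have := @average_failure R S A H n delta q eps S_gt0 A_gt2 H_gt1 delta_ge0 delta_le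
    q_ge0 q_le4 Aq_le1 few eps0 (pol w) (fun D => valg w _) gap_ge.
  move/le_trans; apply; apply: ler_sum => b _; apply: ler_sum => D _.
  rewrite ler_wpM2l// ler_nat.
  by case: (boolP (eps <= _)) => // h; rewrite mem_set.
(* Some instance is at least as bad as the average. *)
have [b le_b] : exists b, 8^-1 <= \sum_D data_prob (hard b) mu D * fine (Pr (E b D)).
  apply/not_existsP => lt_b.
  move: avg; apply/negP; rewrite -ltNge -sum1_card natr_sum mulr_suml.
  apply: ltr_sum => [|b _]; last by rewrite mul1r ltNge; apply/negP; exact: lt_b.
  by apply/hasP; exists [ffun=> false]; rewrite ?mem_index_enum.
exists (hard b), mu; split; first exact: valid_hard.
split; first exact: valid_behavior.
split; last by rewrite failE lee_fin.
move=> t s a; have -> : dm = q / S%:R by rewrite /q mulrAC mulfV ?mul1r// gt_eqF.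
exact: occupancy_behavior_ge.
Qed.
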